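(* Let $A,B$ be complex $2\times 2$ matrices. The following are equivalent: (1) $A$ and $B$ have identical pseudospectra, i.e. $\|(zI-A)^{-1}\|=\|(zI-B)^{-1}\|$ for all $z\in\mathbb{C}$; (2) $A$ and $B$ are polynomially isometric, i.e. $\|p(A)\|=\|p(B)\|$ for every complex polynomial $p$; (3) $A$ and $B$ have super-identical pseudospectra, i.e. $s_k(zI-A)=s_k(zI-B)$ for all $z\in\mathbb{C}$ and $k=1,2$; (4) $A$ and $B$ are unitarily similar.
   Context: $\|\cdot\|$ is the spectral norm. By convention $\|(zI-T)^{-1}\|=\infty$ for $z$ an eigenvalue of $T$. For a $d\times d$ matrix $T$, $s_1(T)\ge\cdots\ge s_d(T)$ denote its singular values (nonnegative square roots of the eigenvalues of $T^*T$, in nonincreasing order). *)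

(* Defs.v *)
From HB Require Import structures.
From mathcomp Require Import all_boot all_order all_algebra.
From mathcomp Require Import complex.
From mathcomp Require Import all_classical all_reals.
Set Implicit Arguments. Unset Strict Implicit. Unset Printing Implicit Defensive.
Import Order.TTheory GRing.Theory Num.Theory.
Local Open Scope ring_scope.
Local Open Scope classical_set_scope.

Section Defs.
Variable R : realType.
Local Notation C := R[i].

Definition cmod (z : C) : R := ComplexField.Normc.normc z.

Definition vnorm n (x : 'cV[C]_n) : R := Num.sqrt (\sum_i cmod (x i 0) ^+ 2).

Definition opnorm m n (M : 'M[C]_(m, n)) : R :=
  sup [set vnorm (M *m x) | x in [set x : 'cV[C]_n | vnorm x = 1]].

Definition adjmx m n (M : 'M[C]_(m, n)) : 'M[C]_(n, m) := map_mx Num.conj (M^T).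

Definition resolvent_norm d (T : 'M[C]_d) (z : C) : \bar R :=
  if (z%:M - T) \in unitmx then (opnorm (invmx (z%:M - T)))%:E else +oo%E.

Definition is_singular_values d (T : 'M[C]_d) (s : seq R) : Prop :=
  [/\ size s = d, sorted (fun a b => b <= a) s, all (fun a => 0 <= a) s &
      char_poly (adjmx T *m T) = \prod_(a <- s) ('X - (real_complex R (a ^+ 2))%:P)].

Definition singular_values d (T : 'M[C]_d) : seq R :=
  xget [::] [set s | is_singular_values T s].

(* s_k(T), k = 1, ..., d *)
Definition sing_val d (T : 'M[C]_d) (k : nat) : R := nth 0 (singular_values T) k.-1.

Definition unitary_mx d (U : 'M[C]_d) : Prop := adjmx U *m U = 1%:M.

End Defs.

(* Main.v *)
Require Import Defs.
From HB Require Import structures.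
From mathcomp Require Import all_boot all_order all_algebra.
From mathcomp Require Import complex.
From mathcomp Require Import all_classical all_reals.
From mathcomp Require Import ring.
Set Implicit Arguments.
Unset Strict Implicit.
Unset Printing Implicit Defensive.

Import Order.TTheory GRing.Theory Num.Theory.
Local Open Scope ring_scope.

Local Notation "x %:C" := (real_complex _ x).

(** A 2x2 matrix is determined up to unitary similarity by its characteristic
    polynomial and [tr (A^* A)]: in the Schur form with a prescribed eigenvalue
    first and a nonnegative off-diagonal entry, that entry is read off from
    [tr (A^* A)].  Each of the first three conditions recovers both invariants.
    The spectrum is visible as the set where the resolvent is infinite, as the
    set of common roots of the polynomials annihilating the matrix, or as the
    set where [s_1 s_2 = |det (z - A)|] vanishes; in dimension two it determines
    the characteristic polynomial.  Since the operator norm is [s_1], and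
    [s_1 s_2] is the modulus of the determinant, the norm and the determinant
    of a matrix [M] give [s_1^2 + s_2^2 = tr (M^* M)].  This applies to [A], to
    [z - A], or to [(z - A)^-1] for a single [z] outside the spectrum. *)

(** * Adjoints, singular values and the operator norm *)

Section Adjoint.
Variable R : realType.
Local Notation C := R[i].

Lemma cmodE (z : C) : (cmod z)%:C = `|z|.
Proof. by []. Qed.

Lemma adjmxM m n p (M : 'M[C]_(m, n)) (N : 'M[C]_(n, p)) :
  adjmx (M *m N) = adjmx N *m adjmx M.
Proof. by rewrite /adjmx trmx_mul map_mxM. Qed.

Lemma adjmxK m n (M : 'M[C]_(m, n)) : adjmx (adjmx M) = M.
Proof. by apply/matrixP=> i j; rewrite !mxE conjCK. Qed.

Lemma vnorm_sqr n (x : 'cV[C]_n) : ((vnorm x) ^+ 2)%:C = (adjmx x *m x) 0 0.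
Proof.
rewrite /vnorm sqr_sqrtr; last by apply: sumr_ge0 => i _; exact: sqr_ge0.
rewrite mxE rmorph_sum; apply: eq_bigr => i _.
by rewrite !mxE mulrC -normCK -cmodE rmorphXn.
Qed.

Lemma vnorm_ge0 n (x : 'cV[C]_n) : 0 <= vnorm x.
Proof. exact: sqrtr_ge0. Qed.

Lemma vnorm_unitary n (U : 'M[C]_n) (x : 'cV[C]_n) :
  unitary_mx U -> vnorm (U *m x) = vnorm x.
Proof.
move=> UU; apply/eqP; rewrite -(@eqrXn2 _ 2) ?vnorm_ge0 //; apply/eqP.
apply: (@complexI R); rewrite !vnorm_sqr adjmxM mulmxA -(mulmxA (adjmx x)).
by rewrite UU mulmx1.
Qed.

Lemma unitary_adjmx n (U : 'M[C]_n) : unitary_mx U -> unitary_mx (adjmx U).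
Proof. by move=> UU; rewrite /unitary_mx adjmxK; apply: mulmx1C. Qed.

Lemma unitary_mulmx n (U V : 'M[C]_n) :
  unitary_mx U -> unitary_mx V -> unitary_mx (U *m V).
Proof.
move=> UU VV; rewrite /unitary_mx adjmxM mulmxA -(mulmxA (adjmx V)).
by rewrite UU mulmx1.
Qed.

Lemma det_adjmx n (M : 'M[C]_n) : \det (adjmx M) = (\det M)^*.
Proof. by rewrite /adjmx det_map_mx det_tr. Qed.

Lemma mxtrace_adjmx n (M : 'M[C]_n) : \tr (adjmx M) = (\tr M)^*.
Proof. by rewrite /adjmx trace_map_mx mxtrace_tr. Qed.

Lemma char_poly_conj n (P M N : 'M[C]_n) : P *m N = 1%:M ->
  char_poly (P *m M *m N) = char_poly M.
Proof.
move=> PN.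
pose Pp := map_mx polyC P; pose Np := map_mx polyC N.
have PNp : Pp *m Np = 1%:M by rewrite -map_mxM PN map_mx1.
rewrite /char_poly.
have -> : char_poly_mx (P *m M *m N) = Pp *m char_poly_mx M *m Np.
  by rewrite /char_poly_mx mulmxBr mulmxBl !map_mxM
    mul_mx_scalar -scalemxAl PNp scalemx1.
by rewrite !det_mulmx mulrAC -det_mulmx PNp det1 mul1r.
Qed.

(** [M^* M] is self-adjoint, so the spectral theorem diagonalizes it. Each diagonal entry is the
    squared norm of a column of [M P^*], hence nonnegative. *)
Lemma gram_spectral n (M : 'M[C]_n) : exists (P : 'M[C]_n) (d : 'I_n -> R),
  [/\ unitary_mx P, forall i, 0 <= d i &
      adjmx M *m M = adjmx P *m diag_mx (\row_i (d i)%:C) *m P].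
Proof.
set G := adjmx M *m M.
have GG : adjmx G = G by rewrite /G adjmxM adjmxK.
have Gn : G \is normalmx.
  by apply/normalmxP; rewrite -/(adjmx G) GG.
have GE := orthomx_spectralP Gn.
have Uu := spectral_unitarymx G.
rewrite (invmx_unitary Uu) in GE.
set P := spectralmx G in GE Uu; set D := spectral_diag G in GE.
change (G = adjmx P *m diag_mx D *m P) in GE.
have PP : unitary_mx P.
  by apply: mulmx1C; apply/unitarymxP.
have DE : adjmx (M *m adjmx P) *m (M *m adjmx P) = diag_mx D.
  rewrite adjmxM adjmxK !mulmxA -(mulmxA P) -/G GE !mulmxA.
  by rewrite (mulmx1C PP) mul1mx -mulmxA (mulmx1C PP) mulmx1.
have D0 i : 0 <= D 0 i.
  have := congr1 (fun X : 'M_n => X i i) DE; rewrite [RHS]mxE eqxx mulr1n => <-.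
  rewrite mxE; apply: sumr_ge0 => k _.
  by rewrite !mxE mulrC -normCK exprn_ge0.
exists P, (fun i => complex.Re (D 0 i)); split=> // [i|].
  by have := D0 i; rewrite lecE => /andP[].
rewrite GE; congr (_ *m diag_mx _ *m _); apply/rowP => i.
by rewrite mxE RRe_real // ger0_real.
Qed.

Lemma char_poly_gram n (M P : 'M[C]_n) (d : 'I_n -> R) : unitary_mx P ->
  adjmx M *m M = adjmx P *m diag_mx (\row_i (d i)%:C) *m P ->
  char_poly (adjmx M *m M) = \prod_i ('X - (d i)%:C%:P).
Proof.
move=> PP ->; rewrite char_poly_conj // char_poly_trig ?diag_mx_is_trig //.
by apply: eq_bigr => i _; rewrite !mxE eqxx mulr1n.
Qed.

(** [singular_values] falls back to [[::]] when no list meets its specification; this rules the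
    default out. *)
Lemma singular_values_exist n (M : 'M[C]_n) : exists s, is_singular_values M s.
Proof.
have [P [d [PP d0 GE]]] := gram_spectral M.
pose geR := fun a b : R => b <= a.
pose s := sort geR [seq Num.sqrt (d i) | i <- enum 'I_n].
exists s; split.
- by rewrite size_sort size_map size_enum_ord.
- by apply: sort_sorted => a b; rewrite /geR le_total.
- rewrite /s all_sort; apply/allP => _ /mapP[i _ ->]; exact: sqrtr_ge0.
- rewrite (char_poly_gram PP GE) /s.
  rewrite (perm_big _ (permEl (perm_sort _ _))) big_map big_enum.
  by apply: eq_bigr => i _; rewrite sqr_sqrtr.
Qed.

Lemma singular_valuesP n (M : 'M[C]_n) : is_singular_values M (singular_values M).
Proof.
have [s sP] := singular_values_exist M; exact: (@xgetI _ _ _ s).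
Qed.

(** The specification sees a matrix only through the characteristic polynomial of its Gram matrix,
    so [xget] chooses from the same set for both. *)
Lemma sing_val_gram n (M N : 'M[C]_n) k :
  char_poly (adjmx M *m M) = char_poly (adjmx N *m N) ->
  sing_val M k = sing_val N k.
Proof.
move=> MN; rewrite /sing_val /singular_values.
suff -> : is_singular_values M = is_singular_values N by [].
by apply/funext => s; rewrite /is_singular_values MN.
Qed.

(** In an eigenbasis of [M^* M], the squared norm of [M x] is the sum of the [|(P x)_i|^2] weighted
    by the eigenvalues. On unit vectors it is bounded by the largest eigenvalue, and an eigenvector
    attains the bound. *)
Lemma opnorm_sing_val n (M : 'M[C]_n.+1) : opnorm M = sing_val M 1.
Proof.
have [P [d [PP d0 GE]]] := gram_spectral M.
have := singular_valuesP M; rewrite /sing_val /=.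
case: (singular_values M) => [[]//|a s [_ /= as_sorted /andP[a0 s0]]].
rewrite (char_poly_gram PP GE) => cE.
have Mx x : vnorm (M *m x) ^+ 2 = \sum_i d i * cmod ((P *m x) i 0) ^+ 2.
  apply: (@complexI R); rewrite vnorm_sqr adjmxM !mulmxA -(mulmxA (adjmx x)) GE.
  rewrite !mulmxA -adjmxM -!mulmxA mul_diag_mx mxE rmorph_sum.
  apply: eq_bigr => i _; rewrite !mxE rmorphM rmorphXn [_ (cmod _)]cmodE normCK.
  by rewrite /= mulrC -mulrA mulrC -!mulrA; congr (_ * _); rewrite mulrC.
(* Two factorizations of one polynomial have the same roots, so the [d i] and the squared singular
   values form the same set. *)
have memE z : (z \in [seq (d i)%:C | i <- enum 'I_n.+1]) =
              (z \in [seq (b ^+ 2)%:C | b <- a :: s]).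
  by rewrite -!root_prod_XsubC big_map big_enum big_map -cE.
have d_le i : d i <= a ^+ 2.
  have : (d i)%:C \in [seq (b ^+ 2)%:C | b <- a :: s].
    by rewrite -memE; apply: map_f; rewrite mem_enum.
  case/mapP => b bs /complexI ->.
  move: bs; rewrite inE => /predU1P[->//|bs].
  have ge_trans : transitive (fun a b : R => b <= a).
    by move=> y x z xy yz; apply: le_trans yz xy.
  have ba : b <= a by move/(order_path_min ge_trans)/allP: as_sorted; apply.
  by rewrite ler_sqr ?nnegrE // (allP s0).
have [j dj] : exists j, d j = a ^+ 2.
  have : (a ^+ 2)%:C \in [seq (d i)%:C | i <- enum 'I_n.+1].
    by rewrite memE mem_head.
  by case/mapP => j _ /complexI ->; exists j.
have vnormE n' (x : 'cV[C]_n') : vnorm x ^+ 2 = \sum_i cmod (x i 0) ^+ 2.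
  by rewrite sqr_sqrtr //; apply: sumr_ge0 => i _; exact: sqr_ge0.
have ub x : vnorm x = 1 -> vnorm (M *m x) <= a.
  move=> x1; rewrite -ler_sqr ?nnegrE ?vnorm_ge0 // Mx.
  apply: (@le_trans _ _ (\sum_i a ^+ 2 * cmod ((P *m x) i 0) ^+ 2)).
    by apply: ler_sum => i _; rewrite ler_wpM2r ?sqr_ge0.
  by rewrite -mulr_sumr -vnormE vnorm_unitary // x1 expr1n mulr1.
(* [x] is a unit eigenvector of [M^* M] for its top eigenvalue [d j]. *)
pose e : 'cV[C]_n.+1 := delta_mx j 0; pose x := adjmx P *m e.
have cmod_e i : cmod (e i 0) ^+ 2 = (i == j)%:R.
  apply: (@complexI R); rewrite rmorphXn /= cmodE mxE eqxx andbT.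
  by case: eqP; rewrite ?normr1 ?normr0 ?expr1n ?expr0n.
have x1 : vnorm x = 1.
  rewrite vnorm_unitary; last exact: unitary_adjmx.
  rewrite /vnorm (bigD1 j) //= cmod_e eqxx big1 ?addr0 ?sqrtr1 // => i.
  by rewrite cmod_e => /negbTE ->.
have Mxa : vnorm (M *m x) = a.
  apply/eqP; rewrite -(@eqrXn2 _ 2) ?vnorm_ge0 // Mx mulmxA (mulmx1C PP) mul1mx.
  rewrite (bigD1 j) //= cmod_e eqxx mulr1 dj big1 ?addr0 // => i.
  by rewrite cmod_e => /negbTE ->; rewrite mulr0.
apply/eqP; rewrite eq_le; apply/andP; split.
  by apply: ge_sup => [|_ [y /= y1 <-]]; [exists a, x | exact: ub].
by apply: ub_le_sup; [exists a => _ [y /= y1 <-]; exact: ub | exists x].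
Qed.

(** Vieta's formulas for the characteristic polynomial of [M^* M]: its roots are the squared
    singular values, and [det (M^* M) = |det M|^2]. *)
Lemma sing_val2E (M : 'M[C]_2) :
  [/\ 0 <= sing_val M 2 <= sing_val M 1,
      (sing_val M 1 ^+ 2 + sing_val M 2 ^+ 2)%:C = \tr (adjmx M *m M) &
      (sing_val M 1 * sing_val M 2)%:C = `|\det M|].
Proof.
have := singular_valuesP M; rewrite /sing_val /=.
case: (singular_values M) => [|a [|b [|? ?]]] [] //= _.
rewrite andbT => ba /and3P[a0 b0 _] cE.
have {}cE : char_poly (adjmx M *m M) =
    \prod_(x <- [:: (a ^+ 2)%:C; (b ^+ 2)%:C]) ('X - x%:P).
  by rewrite cE !big_cons !big_nil.
split; first by rewrite b0 ba.
- have := char_poly_trace (adjmx M *m M) isT; rewrite cE.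
  rewrite (@coefPn_prod_XsubC _ [:: _; _]) // => /oppr_inj <-.
  by rewrite big_cons big_seq1 rmorphD.
- have := char_poly_det (adjmx M *m M); rewrite cE coef0_prod_XsubC /=.
  rewrite expr2 mulrNN !mul1r det_mulmx det_adjmx mulrC -normCK => E.
  apply/eqP; rewrite -(@eqrXn2 _ 2) ?normr_ge0 ?ler0c ?mulr_ge0 //.
  by rewrite -E big_cons big_seq1 -rmorphXn -rmorphM exprMn.
Qed.
End Adjoint.

(** * The characteristic polynomial and [tr (M^* M)] as invariants of 2x2 matrices *)

Section TwoByTwo.
Variable R : realType.
Local Notation C := R[i].
Implicit Types A B M N : 'M[C]_2.

(** If [s_1] is nonzero, [s_1] and [s_1 s_2] determine [s_2]; otherwise the ordering forces
    [s_2 = 0]. *)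
Lemma gram_trace_opnorm_det M N : opnorm M = opnorm N ->
  `|\det M| = `|\det N| -> \tr (adjmx M *m M) = \tr (adjmx N *m N).
Proof.
rewrite !opnorm_sing_val.
have [/andP[a0 ab] <- <-] := sing_val2E M; have [/andP[c0 cd] <- <-] := sing_val2E N.
move=> E; rewrite -E in cd *; move=> /complexI E2.
have [s0|s0] := eqVneq (sing_val M 1) 0; last by rewrite (mulfI s0 E2).
rewrite s0 in ab cd.
have -> : sing_val M 2 = 0 by apply/eqP; rewrite eq_le a0 ab.
by have -> : sing_val N 2 = 0 by apply/eqP; rewrite eq_le c0 cd.
Qed.

Lemma horner_char_poly n (M : 'M[C]_n) z : (char_poly M).[z] = \det (z%:M - M).
Proof.
rewrite -horner_evalE -det_map_mx; congr (\det _).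
apply/matrixP=> i j; rewrite !mxE /= horner_evalE hornerD hornerN hornerMn.
by rewrite hornerX hornerC.
Qed.

Lemma root_char_polyE n (M : 'M[C]_n) z :
  root (char_poly M) z = (z%:M - M \notin unitmx).
Proof. by rewrite rootE horner_char_poly unitmxE unitfE negbK. Qed.

Lemma char_poly_roots M : exists a b, char_poly M = ('X - a%:P) * ('X - b%:P).
Proof.
have [r] := closed_field_poly_normal (char_poly M).
rewrite (monicP (char_poly_monic M)) scale1r => E.
have := size_char_poly M; rewrite E size_prod_XsubC => -[].
case: r E => [|a [|b []]] // E _; exists a, b.
by rewrite big_cons big_seq1.
Qed.

(* Two unordered pairs with the same underlying set are equal. *)
Lemma eq_root_char_poly A B : root (char_poly A) =1 root (char_poly B) ->
  char_poly A = char_poly B.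
Proof.
have [a [b ->]] := char_poly_roots A; have [c [d ->]] := char_poly_roots B.
move=> E; have {}E z : (z == a) || (z == b) = (z == c) || (z == d).
  by have := E z; rewrite !rootM !root_XsubC.
have := E a; have := E b; have := E c; have := E d; rewrite !eqxx ?orbT /=.
move=> /orP[]/eqP ? /orP[]/eqP ? /esym/orP[]/eqP ? /esym/orP[]/eqP ?; subst=> //.
all: by rewrite mulrC.
Qed.

Lemma gram_traceE m n (M : 'M[C]_(m, n)) :
  \tr (adjmx M *m M) = \sum_i \sum_j `|M j i| ^+ 2.
Proof.
apply: eq_bigr => i _; rewrite mxE; apply: eq_bigr => j _.
by rewrite !mxE normCK mulrC.
Qed.

Lemma ord2_case (i : 'I_2) : i = 0 \/ i = 1.
Proof. by case: i => [[|[|//]]] lt2; [left|right]; apply: val_inj. Qed.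

Lemma sum_ord2 (V : nmodType) (F : 'I_2 -> V) : \sum_i F i = F 0 + F 1.
Proof.
rewrite !big_ord_recl big_ord0 addr0; congr (_ + F _); exact: val_inj.
Qed.

(** Up to signs and positions, the adjugate of a 2x2 matrix has the entries of the matrix itself,
    hence the same Frobenius norm. *)
Lemma gram_trace_invmx M : M \in unitmx ->
  \tr (adjmx (invmx M) *m invmx M) = \tr (adjmx M *m M) / `|\det M| ^+ 2.
Proof.
have lift0 : lift 0 0 = 1 :> 'I_2 by exact: val_inj.
have lift1 : lift 1 0 = 0 :> 'I_2 by exact: val_inj.
move=> Mu; rewrite !gram_traceE /invmx Mu !sum_ord2 !mxE.
rewrite /cofactor !det_mx11 !mxE /= !lift0 !lift1.
rewrite !normrM !normfV !normrX !normrN1 !expr1n !mul1r !exprMn exprVn; ring.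
Qed.

Lemma gram_trace_opnorm_invmx M N : M \in unitmx -> N \in unitmx ->
  \det M = \det N -> opnorm (invmx M) = opnorm (invmx N) ->
  \tr (adjmx M *m M) = \tr (adjmx N *m N).
Proof.
move=> Mu Nu dE /gram_trace_opnorm_det; rewrite !det_inv dE => /(_ erefl).
rewrite (gram_trace_invmx Mu) (gram_trace_invmx Nu) dE; apply: mulIf.
by rewrite invr_eq0 expf_neq0 // normr_eq0 -unitfE -unitmxE.
Qed.

(** All terms but the last depend only on [z] and [tr A], so the shift can be undone once the
    characteristic polynomials agree. *)
Lemma gram_trace_shift n (A : 'M[C]_n) (z : C) :
  \tr (adjmx (z%:M - A) *m (z%:M - A)) =
  `|z| ^+ 2 *+ n - z^* * \tr A - z * (\tr A)^* + \tr (adjmx A *m A).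
Proof.
have -> : adjmx (z%:M - A) = z^*%:M - adjmx A.
  by rewrite /adjmx linearB /= tr_scalar_mx map_mxB map_scalar_mx.
rewrite mulmxBl !mulmxBr -scalar_mxM mul_scalar_mx mul_mx_scalar !linearB /=.
rewrite mxtrace_scalar !mxtraceZ mxtrace_adjmx mulrC -normCK.
by ring.
Qed.

Lemma gram_trace_conj n (U M : 'M[C]_n) : unitary_mx U ->
  \tr (adjmx (adjmx U *m M *m U) *m (adjmx U *m M *m U)) = \tr (adjmx M *m M).
Proof.
move=> UU; rewrite mxtrace_mulC !adjmxM adjmxK !mulmxA -(mulmxA _ U (adjmx U)).
rewrite (mulmx1C UU) mulmx1 mxtrace_mulC !mulmxA (mulmx1C UU) mul1mx.
by rewrite mxtrace_mulC.
Qed.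

Lemma eq_char_poly_trace A B : char_poly A = char_poly B -> \tr A = \tr B.
Proof.
move=> cAB; have := char_poly_trace A isT; rewrite cAB.
by rewrite (char_poly_trace B isT) => /oppr_inj.
Qed.

Lemma eq_char_poly_det n (A B : 'M[C]_n) :
  char_poly A = char_poly B -> \det A = \det B.
Proof.
move=> cAB; have := char_poly_det A; rewrite cAB char_poly_det.
by move/(mulfI (negbT (signr_eq0 _ n))).
Qed.

(* The phase [t] of the second basis vector is free; it is chosen to make the
   off-diagonal entry nonnegative. *)
Lemma schur_form A a : root (char_poly A) a -> exists (U : 'M[C]_2) (b : C),
  [/\ unitary_mx U, 0 <= b & adjmx U *m A *m U =
    \matrix_(i, j) (if i == 0 then if j == 0 then a else 0
                    else if j == 0 then b else \tr A - a)].
Proof.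
(* [v] is a row vector, that is, a left eigenvector; this is why the triangular form is lower. *)
rewrite -eigenvalue_root_char => /eigenvalueP[v vA v0].
pose N := sqrtC (`|v 0 0| ^+ 2 + `|v 0 1| ^+ 2).
have N0 : N != 0.
  rewrite sqrtC_eq0; apply: contra v0.
  rewrite paddr_eq0 ?exprn_ge0 // !expf_eq0 /= !normr_eq0 => /andP[/eqP v0 /eqP v1].
  by apply/eqP/rowP => i; rewrite mxE; case: (ord2_case i) => ->.
have Nr : N^* = N.
  by apply/CrealP/ger0_real; rewrite sqrtC_ge0 addr_ge0 ?exprn_ge0.
pose x := v 0 0 / N; pose y := v 0 1 / N.
have xy1 : x * x^* + y * y^* = 1.
  rewrite /x /y !rmorphM !fmorphV /= Nr !mulrA.
  have -> : v 0 0 / N * (v 0 0)^* / N + v 0 1 / N * (v 0 1)^* / N =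
    (`|v 0 0| ^+ 2 + `|v 0 1| ^+ 2) / N ^+ 2 by rewrite !normCK; field.
  by rewrite sqrtCK divff // -(sqrtCK (_ + _)) expf_neq0.
have xE : N^-1 * v 0 0 = x by rewrite mulrC.
have yE : N^-1 * v 0 1 = y by rewrite mulrC.
clearbody x y.
(* The lower left entry of [P A P^*] (with [P] as below) for the phase [t = 1]. *)
pose b0 := (- y^* * A 0 0 + x^* * A 1 0) * x^* + (- y^* * A 0 1 + x^* * A 1 1) * y^*.
have [t tt tb] : exists2 t : C, t * t^* = 1 & t * b0 = `|b0|.
  have [->|nb0] := eqVneq b0 0.
    by exists 1; rewrite ?rmorph1 ?mulr1 ?mulr0 ?normr0.
  have nN : `|b0| != 0 by rewrite normr_eq0.
  exists (b0^* / `|b0|).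
    rewrite rmorphM fmorphV /= conjCK conj_normC.
    by rewrite mulrACA mulrC -invfM -expr2 normCK mulrC
      [_^* * _]mulrC divff // mulf_neq0 // conjC_eq0.
  by rewrite mulrAC [_^* * _]mulrC -normCK expr2 mulfK.
pose P : 'M[C]_2 := \matrix_(i, j)
  (if i == 0 then if j == 0 then x else y
   else if j == 0 then - t * y^* else t * x^*).
have PP : P *m adjmx P = 1%:M.
  apply/matrixP => i j; rewrite !mxE !sum_ord2 !mxE /=.
  case: (ord2_case i) => ->; case: (ord2_case j) => -> /=;
    rewrite ?rmorphM ?rmorphN /= ?conjCK ?mulr1n ?mulr0n.
  - exact: xy1.
  - ring.
  - ring.
  - by rewrite -[1]mulr1 -{1}tt -{1}xy1 /=; ring.
have row0 : row 0 P *m A = a *: row 0 P.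
  have -> : row 0 P = N^-1 *: v.
    apply/rowP=> j; rewrite !mxE /=.
    by case: (ord2_case j) => -> /=; rewrite ?xE ?yE.
  by rewrite -scalemxAl vA !scalerA mulrC.
(* The first row of [P] is a left eigenvector, so the first row of [P A P^*] is [a] times that of
   [P P^* = 1]. *)
have T0 j : (P *m A *m adjmx P) 0 j = a * (0 == j)%:R.
  have := congr1 (fun X : 'M_2 => X 0 j) PP; rewrite [RHS]mxE => <-.
  rewrite -[LHS]mulr1.
  have -> : (P *m A *m adjmx P) 0 j = (row 0 P *m A *m adjmx P) 0 j.
    by rewrite -!row_mul [RHS]mxE.
  by rewrite mulr1 row0 -scalemxAl mxE -row_mul mxE.
exists (adjmx P), `|b0|; split => //.
  by rewrite /unitary_mx adjmxK.
rewrite adjmxK; apply/matrixP => i j; rewrite [RHS]mxE.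
have T1 : (P *m A *m adjmx P) 1 1 = \tr A - a.
  have <- : \tr (P *m A *m adjmx P) = \tr A.
    by rewrite mxtrace_mulC mulmxA (mulmx1C PP) mul1mx.
  by rewrite /mxtrace sum_ord2 T0 eqxx mulr1 [RHS]addrC addKr.
case: (ord2_case i) => ->; case: (ord2_case j) => -> /=.
- by rewrite T0 mulr1.
- by rewrite T0 mulr0.
- rewrite -tb /b0 !mxE !sum_ord2 !mxE !sum_ord2 !mxE /=; ring.
- exact: T1.
Qed.

Lemma unitary_similarity_invariants A B : char_poly A = char_poly B ->
  \tr (adjmx A *m A) = \tr (adjmx B *m B) ->
  exists U : 'M[C]_2, unitary_mx U /\ B = adjmx U *m A *m U.
Proof.
move=> cAB fAB.
have [a ra] : exists a, root (char_poly A) a.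
  have [a [b ->]] := char_poly_roots A; exists a.
  by rewrite rootM root_XsubC eqxx.
have trAB := eq_char_poly_trace cAB.
have [U [b [UU b0 AE]]] := schur_form ra.
have rb : root (char_poly B) a by rewrite -cAB.
have [V [c [VV c0 BE]]] := schur_form rb.
(* Both forms have the same diagonal, so equal Frobenius norms leave [|b|^2 = |c|^2], with [b] and
   [c] nonnegative. *)
have bc : b = c.
  apply/eqP; rewrite -(@eqrXn2 _ 2) //; apply/eqP.
  have := fAB; rewrite -(gram_trace_conj A UU) -(gram_trace_conj B VV) AE BE.
  rewrite !gram_traceE !sum_ord2 !mxE /= trAB.
  rewrite (ger0_norm b0) (ger0_norm c0).
  by move=> /addIr/addrI.
(* [U] and [V] bring [A] and [B] to the same triangular matrix. *)
exists (U *m adjmx V); split.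
  by apply: unitary_mulmx => //; apply: unitary_adjmx.
rewrite adjmxM adjmxK !mulmxA -[X in X *m adjmx V]mulmxA -(mulmxA V).
rewrite (mulmxA (adjmx U)) AE bc trAB -BE !mulmxA.
by rewrite (mulmx1C VV) mul1mx -mulmxA (mulmx1C VV) mulmx1.
Qed.

(** * From each of the first three conditions to unitary similarity *)

Lemma opnorm_eq0 M : opnorm M = 0 <-> M = 0.
Proof.
have [/andP[b0 ba] trE _] := sing_val2E M; rewrite opnorm_sing_val.
split=> [a0|M0].
  have {}b0 : sing_val M 2 = 0 by apply/eqP; rewrite eq_le b0 -a0 ba.
  have M0 i j : `|M j i| ^+ 2 = 0.
    move: trE; rewrite a0 b0 expr0n addr0 gram_traceE => /esym/eqP.
    rewrite psumr_eq0; last by move=> k _; apply: sumr_ge0 => l _; rewrite exprn_ge0.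
    move=> /allP/(_ i (mem_index_enum _)) /=.
    rewrite psumr_eq0; last by move=> l _; rewrite exprn_ge0.
    by move=> /allP/(_ j (mem_index_enum _)) /eqP.
  apply/matrixP => j i; rewrite mxE; apply/eqP.
  by rewrite -normr_eq0 -sqrf_eq0 M0.
move: trE; rewrite M0 mulmx0 mxtrace0 => /complexI/eqP.
by rewrite paddr_eq0 ?sqr_ge0 // expf_eq0 /= => /andP[/eqP].
Qed.

(** Eigenvalues are roots of the minimal polynomial, which divides every annihilating polynomial. *)
Lemma root_char_poly_dvd n (A : 'M[C]_n.+1) p z : horner_mx A p = 0 ->
  root (char_poly A) z -> root p z.
Proof.
move=> /mxminpoly_min dvd; rewrite -eigenvalue_root_char eigenvalue_root_min.
by rewrite -!dvdp_XsubCl => zA; apply: dvdp_trans zA dvd.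
Qed.

Lemma gram_trace_unshift A B z : char_poly A = char_poly B ->
  \tr (adjmx (z%:M - A) *m (z%:M - A)) = \tr (adjmx (z%:M - B) *m (z%:M - B)) ->
  \tr (adjmx A *m A) = \tr (adjmx B *m B).
Proof.
move=> cAB; rewrite !gram_trace_shift.
rewrite (eq_char_poly_trace cAB); exact: addrI.
Qed.

Lemma identical_pseudospectra_similar A B :
  (forall z, resolvent_norm A z = resolvent_norm B z) ->
  exists U : 'M[C]_2, unitary_mx U /\ B = adjmx U *m A *m U.
Proof.
move=> rE.
have cAB : char_poly A = char_poly B.
  apply: eq_root_char_poly => z; rewrite !root_char_polyE; have := rE z.
  rewrite /resolvent_norm; case: (z%:M - A \in unitmx); case: (z%:M - B \in unitmx).
  - by move=> _.
  - by move=> E; discriminate E.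
  - by move=> E; discriminate E.
  - by move=> _.
have [z zA] : exists z, z%:M - A \in unitmx.
  have [a [b cE]] := char_poly_roots A.
  (* If equality held, [u] would be nonnegative, hence equal to [|u|], which is strictly smaller
     than the left side. *)
  have neq (u w : C) : `|u| + `|w| + 1 != u.
    apply/eqP => E; have u0 : 0 <= u by rewrite -E !addr_ge0.
    have : `|u| < `|u| + `|w| + 1 by rewrite -addrA ltrDl ltr_wpDl.
    by rewrite E ger0_norm // ltxx.
  exists (`|a| + `|b| + 1).
  rewrite -[_ \in _]negbK -root_char_polyE cE rootM !root_XsubC negb_or neq.
  by rewrite [`|a| + _]addrC neq.
have zB : z%:M - B \in unitmx.
  by rewrite -[_ \in _]negbK -root_char_polyE -cAB root_char_polyE negbK.
apply: (unitary_similarity_invariants cAB); apply: (gram_trace_unshift (z := z) cAB).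
apply: (gram_trace_opnorm_invmx zA zB); first by rewrite -!horner_char_poly cAB.
have := rE z; rewrite /resolvent_norm zA zB; exact: EFin_inj.
Qed.

Lemma polynomially_isometric_similar A B :
  (forall p, opnorm (horner_mx A p) = opnorm (horner_mx B p)) ->
  exists U : 'M[C]_2, unitary_mx U /\ B = adjmx U *m A *m U.
Proof.
move=> pE.
have cAB : char_poly A = char_poly B.
  (* By Cayley-Hamilton and equality of norms, the characteristic polynomial of each matrix
     annihilates the other. *)
  apply: eq_root_char_poly => z; apply/idP/idP; apply: root_char_poly_dvd.
    by apply/opnorm_eq0; rewrite pE; apply/opnorm_eq0; exact: Cayley_Hamilton.
  by apply/opnorm_eq0; rewrite -pE; apply/opnorm_eq0; exact: Cayley_Hamilton.
apply: (unitary_similarity_invariants cAB); apply: gram_trace_opnorm_det.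
  by have := pE 'X; rewrite !horner_mx_X.
by rewrite (eq_char_poly_det cAB).
Qed.

Lemma super_identical_similar A B :
  (forall z k, (1 <= k <= 2)%N -> sing_val (z%:M - A) k = sing_val (z%:M - B) k) ->
  exists U : 'M[C]_2, unitary_mx U /\ B = adjmx U *m A *m U.
Proof.
move=> sE.
have cAB : char_poly A = char_poly B.
  apply: eq_root_char_poly => z; rewrite !rootE !horner_char_poly
    -!(normr_eq0 (\det _)).
  have [_ _ <-] := sing_val2E (z%:M - A); have [_ _ <-] := sing_val2E (z%:M - B).
  by rewrite !sE.
apply: (unitary_similarity_invariants cAB); apply: (gram_trace_unshift (z := 0) cAB).
have [_ <- _] := sing_val2E (0%:M - A); have [_ <- _] := sing_val2E (0%:M - B).
by rewrite !sE.
Qed.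

End TwoByTwo.

(** * Unitary similarity preserves all the norms and singular values involved *)

Section UnitaryInvariance.
Variable R : realType.
Local Notation C := R[i].
Variables (n : nat) (U : 'M[C]_n.+1).
Hypothesis UU : unitary_mx U.

(** Conjugating [M] by [U] conjugates [M^* M] by [U], which keeps its characteristic polynomial. *)
Lemma sing_val_conj (M : 'M[C]_n.+1) k :
  sing_val (adjmx U *m M *m U) k = sing_val M k.
Proof.
apply: sing_val_gram.
rewrite !adjmxM adjmxK !mulmxA -(mulmxA _ U (adjmx U)) (mulmx1C UU) mulmx1.
by rewrite -2!(mulmxA (adjmx U)) mulmxA char_poly_conj.
Qed.

Lemma opnorm_conj (M : 'M[C]_n.+1) : opnorm (adjmx U *m M *m U) = opnorm M.
Proof. by rewrite !opnorm_sing_val sing_val_conj. Qed.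

Lemma shift_conj (A : 'M[C]_n.+1) z :
  z%:M - adjmx U *m A *m U = adjmx U *m (z%:M - A) *m U.
Proof. by rewrite mulmxBr mulmxBl mul_mx_scalar -scalemxAl UU scalemx1. Qed.

Lemma invmx_conj (M : 'M[C]_n.+1) : M \in unitmx ->
  invmx (adjmx U *m M *m U) = adjmx U *m invmx M *m U.
Proof.
move=> Mu; set X := _ *m U; set Y := _ *m U.
have XY : X *m Y = 1%:M.
  rewrite /X /Y !mulmxA -(mulmxA _ U) (mulmx1C UU) mulmx1.
  by rewrite -(mulmxA _ M) (mulmxV Mu) mulmx1.
have Xu : X \in unitmx by case/mulmx1_unit: XY.
by rewrite -[LHS]mulmx1 -XY (mulKmx Xu).
Qed.

Lemma resolvent_norm_conj (A : 'M[C]_n.+1) z :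
  resolvent_norm (adjmx U *m A *m U) z = resolvent_norm A z.
Proof.
have /mulmx1_unit[Uv Uu] := UU.
rewrite /resolvent_norm shift_conj !unitmx_mul Uv Uu andbT /=.
by case: (boolP (z%:M - A \in unitmx)) => [zA|//];
  rewrite (invmx_conj zA) opnorm_conj.
Qed.

Lemma horner_mx_unitary_conj (A : 'M[C]_n.+1) p :
  horner_mx (adjmx U *m A *m U) p = adjmx U *m horner_mx A p *m U.
Proof.
elim/poly_ind: p => [|p c IH]; first by rewrite !rmorph0 mulmx0 mul0mx.
rewrite !rmorphD !rmorphM /= !horner_mx_X !horner_mx_C IH mulmxDr mulmxDl.
rewrite mul_mx_scalar -scalemxAl UU scalemx1; congr (_ + _).
by rewrite -!mulmxE !mulmxA -(mulmxA _ U) (mulmx1C UU) mulmx1.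
Qed.

End UnitaryInvariance.

Theorem theorem2 (R : realType) (A B : 'M[R[i]]_2) :
  [<-> (forall z : R[i], resolvent_norm A z = resolvent_norm B z);
       (forall p : {poly R[i]}, opnorm (horner_mx A p) = opnorm (horner_mx B p));
       (forall (z : R[i]) (k : nat), (1 <= k <= 2)%N ->
          sing_val (z%:M - A) k = sing_val (z%:M - B) k);
       (exists U : 'M[R[i]]_2, unitary_mx U /\ B = adjmx U *m A *m U)].
Proof.
(* The implications form the cycle (1), (2), (3), (4), (1); the first two pass through unitary
   similarity. *)
tfae.
- move/identical_pseudospectra_similar => [U [UU ->]] p.
  by rewrite (horner_mx_unitary_conj UU) (opnorm_conj UU).
- move/polynomially_isometric_similar => [U [UU ->]] z k _.
  by rewrite (shift_conj UU) (sing_val_conj UU).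
- exact: super_identical_similar.
- by move=> [U [UU ->]] z; rewrite (resolvent_norm_conj UU).
Qed.
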